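(* Let $k\ge 2$ and let $\mathcal{P}$ be a chiral $(2k+1)$-polytope with simple Petrie polygons. Fix a base flag $\Phi$ of $\mathcal{P}$ and for $1\le i\le 2k$ let $\tau_i$ be the automorphism with $\Phi\tau_i=r_ir_0\Phi$, so that $\Gamma(\mathcal{P})=\langle\tau_1,\dots,\tau_{2k}\rangle$. Let $\mathcal{X}$ be the family-2 premaniplex with $4k$ sides, with 1-faces $e_0,\dots,e_{4k-1}$, and let $\xi$ be the voltage assignment on $\mathcal{X}$ giving trivial voltage to all darts of colors 0 and 1, and, for $0\le i<2k$, voltage $\tau_{i+1}$ to each dart of color 2 starting at a flag of $e_i$ (hence voltage $\tau_{i+1}^{-1}$ to the darts of color 2 starting at a flag of $e_{2k+i}$). Then $\mathcal{X}^\xi$ is a polyhedron (abstract 3-polytope) whose symmetry type graph is isomorphic to $\mathcal{X}$. In particular $\mathcal{X}^\xi$ is vertex-transitive, facet-transitive and has trivial facet stabilizer.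
   Context: Graphs may have semi-edges and parallel edges: a graph has vertices, darts, an initial-vertex map $I$ and an involution $d\mapsto d^{-1}$ on darts; $T(d)=I(d^{-1})$. An $n$-premaniplex is a connected graph with edges colored by $\{0,\dots,n-1\}$ such that every vertex (flag) is incident to exactly one edge of each color and for $|i-j|>1$ alternating paths of length 4 in colors $i,j$ are closed; an $n$-maniplex is a simple $n$-premaniplex. $r_i\Phi$ is the flag joined to $\Phi$ by its edge of color $i$. The $i$-faces are the connected components after deleting the color-$i$ edges ($0$-faces: vertices; $(n-1)$-faces: facets). Automorphisms are color-preserving graph automorphisms, acting on the right. An abstract $n$-polytope is an $n$-maniplex such that whenever two flags are joined by a path with colors in $[0,m]$ and by one with colors in $[k',n-1]$, they are joined by a path with colors in $[k',m]$; a polyhedron is a 3-polytope. A maniplex is chiral if its automorphism group has exactly two flag orbits and adjacent flags lie in different orbits. A Petrie polygon is an orbit of flags under $r_{n-1}\cdots r_1r_0$; it is simple if distinct flags in it lie in distinct vertices. Family-2 premaniplex with $4k$ sides: start from a $4k$-gon (a 2-premaniplex whose $8k$ flags form a cycle alternating colors 0,1), fix a flag $y_0$, let $e_i$ ($0\le i\le 4k-1$) be the 1-face $\{(r_1r_0)^iy_0,\ r_0(r_1r_0)^iy_0\}$, and add an edge of color 2 joining each flag $y$ to $r_0(r_1r_0)^{2k}y$ (so flags of $e_i$ are joined to flags of $e_{i+2k}$, indices mod $4k$). A voltage assignment with group $\Gamma$ is a map $\xi$ from darts to $\Gamma$ with $\xi(d^{-1})=\xi(d)^{-1}$. The derived graph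 $\mathcal{X}^\xi$ has vertex set $V(\mathcal{X})\times\Gamma$ and dart set $D(\mathcal{X})\times\Gamma$, the dart $(d,\gamma)$ going from $(I(d),\gamma)$ to $(T(d),\xi(d)\gamma)$, with $(d,\gamma)^{-1}=(d^{-1},\xi(d)\gamma)$ and colors inherited. The symmetry type graph of a maniplex has the flag orbits of its automorphism group as vertices, with an edge of color $i$ between the orbits of $\Phi$ and $r_i\Phi$ (a semi-edge if equal). Vertex-/facet-transitive means the automorphism group is transitive on vertices/facets; trivial facet stabilizer means only the identity maps a facet to itself. *)

(* Defs.v *)
From HB Require Import structures.
From mathcomp Require Import all_boot.
From mathcomp Require Import boolp classical_sets.

Set Implicit Arguments.
Unset Strict Implicit.
Unset Printing Implicit Defensive.

Local Open Scope classical_set_scope.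

(* Edges are the orbits {d, d^-1} of [inv]; a semi-edge is a dart d with
   d^-1 = d.  The last four fields say that each vertex v is the initial vertex
   of exactly one dart of each color i, namely [dart_at v i]; this witness is
   unique, so it carries no extra structure.  Connectedness and the closing of
   alternating paths are imposed in [premaniplex]. *)
Record cgraph (n : nat) := CGraph {
  vert : Type;
  dart : Type;
  init : dart -> vert;
  inv : dart -> dart;
  invK : involutive inv;
  color : dart -> 'I_n;
  color_inv : forall d, color (inv d) = color d;
  dart_at : vert -> 'I_n -> dart;
  init_dart_at : forall v i, init (dart_at v i) = v;
  color_dart_at : forall v i, color (dart_at v i) = i;
  dart_at_uniq : forall d, dart_at (init d) (color d) = d
}.

Section CGraph.
Variables (n : nat) (G : cgraph n).

Definition term (d : dart G) : vert G := init (inv d).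

Definition r (i : 'I_n) (v : vert G) : vert G := term (dart_at v i).

Lemma rK i : involutive (r i).
Proof.
move=> v; rewrite /r /term.
have {2}-> : i = color (inv (dart_at v i)) by rewrite color_inv color_dart_at.
by rewrite dart_at_uniq invK init_dart_at.
Qed.

(* A path starting at v is determined by the sequence of its colors;
   the head of s is the color of the first edge. *)
Definition walk (v : vert G) (s : seq 'I_n) : vert G :=
  foldl (fun w i => r i w) v s.

Definition joined (C : pred 'I_n) (v w : vert G) : Prop :=
  exists s, all C s /\ walk v s = w.

Definition connected : Prop :=
  inhabited (vert G) /\ forall v w, joined predT v w.

Definition premaniplex : Prop :=
  connected /\
  forall i j : 'I_n, (i.+1 < j) || (j.+1 < i) ->
    forall v, walk v [:: i; j; i; j] = v.

Definition simple_graph : Prop :=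
  (forall d, term d <> init d) /\
  (forall d d', init d = init d' -> term d = term d' -> d = d').

Definition maniplex : Prop := premaniplex /\ simple_graph.

Definition polytope : Prop :=
  maniplex /\
  forall (m k : 'I_n) v w,
    joined (fun i => i <= m) v w -> joined (fun i => k <= i) v w ->
    joined (fun i => k <= i <= m) v w.

Definition face (i : 'I_n) (v : vert G) : set (vert G) :=
  [set w | joined (predC1 i) v w].

Definition is_face (i : 'I_n) (F : set (vert G)) : Prop :=
  exists v, F = face i v.

(* [enum 'I_n] is [:: 0; ...; n-1], so this is r_(n-1) ... r_1 r_0 *)
Definition petrie_step (v : vert G) : vert G := walk v (enum 'I_n).

(* the orbit of v under the cyclic group generated by the bijection petrie_step *)
Definition petrie_polygon (v : vert G) : set (vert G) :=
  [set w | exists m, iter m petrie_step v = w \/ iter m petrie_step w = v].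

End CGraph.

Definition simple_petrie_polygons n (G : cgraph n.+1) : Prop :=
  forall u v w : vert G, petrie_polygon u v -> petrie_polygon u w ->
    v <> w -> face ord0 v <> face ord0 w.

Record iso n (G H : cgraph n) := Iso {
  iso_vert :> vert G -> vert H;
  iso_dart : dart G -> dart H;
  iso_vert_inv : vert H -> vert G;
  iso_dart_inv : dart H -> dart G;
  iso_vertK : cancel iso_vert iso_vert_inv;
  iso_vert_invK : cancel iso_vert_inv iso_vert;
  iso_dartK : cancel iso_dart iso_dart_inv;
  iso_dart_invK : cancel iso_dart_inv iso_dart;
  iso_init : forall d, init (iso_dart d) = iso_vert (init d);
  iso_inv : forall d, inv (iso_dart d) = iso_dart (inv d);
  iso_color : forall d, color (iso_dart d) = color d
}.

Lemma iso_r n (G H : cgraph n) (f : iso G H) i v : f (r i v) = r i (f v).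
Proof.
rewrite /r /term; set d := dart_at v i.
have -> : dart_at (f v) i = iso_dart f d.
  by rewrite -[RHS]dart_at_uniq iso_init iso_color init_dart_at color_dart_at.
by rewrite iso_inv iso_init.
Qed.

Definition aut n (G : cgraph n) := iso G G.

Section AutGroup.
Variables (n : nat) (G : cgraph n).
Implicit Types s t : aut G.

Definition aut_one : aut G :=
  @Iso n G G id id id id (fun _ => erefl) (fun _ => erefl) (fun _ => erefl)
    (fun _ => erefl) (fun _ => erefl) (fun _ => erefl) (fun _ => erefl).

Definition aut_inv s : aut G.
Proof.
refine (@Iso n G G (iso_vert_inv s) (iso_dart_inv s) (iso_vert s) (iso_dart s)
  (iso_vert_invK s) (iso_vertK s) (iso_dart_invK s) (iso_dartK s) _ _ _).
- by move=> d; apply: (can_inj (iso_vertK s));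
    rewrite -iso_init iso_dart_invK iso_vert_invK.
- by move=> d; apply: (can_inj (iso_dartK s));
    rewrite -iso_inv !iso_dart_invK.
- by move=> d; rewrite -(iso_color s) iso_dart_invK.
Defined.

(* automorphisms act on the right: v (s * t) = (v s) t *)
Definition aut_mul s t : aut G.
Proof.
refine (@Iso n G G (t \o s) (iso_dart t \o iso_dart s)
  (iso_vert_inv s \o iso_vert_inv t) (iso_dart_inv s \o iso_dart_inv t)
  _ _ _ _ _ _ _).
- exact: can_comp (iso_vertK t) (iso_vertK s).
- exact: can_comp (iso_vert_invK s) (iso_vert_invK t).
- exact: can_comp (iso_dartK t) (iso_dartK s).
- exact: can_comp (iso_dart_invK s) (iso_dart_invK t).
- by move=> d /=; rewrite !iso_init.
- by move=> d /=; rewrite !iso_inv.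
- by move=> d /=; rewrite !iso_color.
Defined.

Lemma autP s t : iso_vert s =1 iso_vert t -> s = t.
Proof.
move=> est.
have dst : iso_dart s =1 iso_dart t.
  move=> d; rewrite -[LHS]dart_at_uniq -[RHS]dart_at_uniq.
  by rewrite !iso_init !iso_color est.
have es't : iso_vert_inv s =1 iso_vert_inv t.
  by move=> v; rewrite -{1}(iso_vert_invK t v) -est iso_vertK.
have ds't : iso_dart_inv s =1 iso_dart_inv t.
  by move=> d; rewrite -{1}(iso_dart_invK t d) -dst iso_dartK.
case: s t est dst es't ds't => [a b c d ? ? ? ? ? ? ?] [a' b' c' d' ? ? ? ? ? ? ?] /=.
move=> /funext ? /funext ? /funext ? /funext ?; subst a' b' c' d'.
by congr Iso; apply: Prop_irrelevance.
Qed.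

Lemma aut_mulA : associative aut_mul. Proof. by move=> s t u; apply: autP. Qed.
Lemma aut_mul1 : left_id aut_one aut_mul. Proof. by move=> s; apply: autP. Qed.
Lemma aut_mul1r : right_id aut_one aut_mul. Proof. by move=> s; apply: autP. Qed.
Lemma aut_mulV : left_inverse aut_one aut_inv aut_mul.
Proof. by move=> s; apply: autP => v /=; rewrite iso_vert_invK. Qed.
Lemma aut_mulVr : right_inverse aut_one aut_inv aut_mul.
Proof. by move=> s; apply: autP => v /=; rewrite iso_vertK. Qed.

HB.instance Definition _ := gen_eqMixin (aut G).
HB.instance Definition _ := gen_choiceMixin (aut G).
HB.instance Definition _ := isGroup.Build (aut G)
  aut_mulA aut_mul1 aut_mul1r aut_mulV aut_mulVr.

End AutGroup.

Inductive generated (gT : groupType) (S : set gT) : gT -> Prop :=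
| gen_in x : S x -> generated S x
| gen_1 : generated S 1%g
| gen_mul x y : generated S x -> generated S y -> generated S (x * y)%g
| gen_inv x : generated S x -> generated S (x^-1)%g.

Definition flag_orbit n (G : cgraph n) (v : vert G) : set (vert G) :=
  [set w | exists s : aut G, s v = w].

Definition chiral n (G : cgraph n) : Prop :=
  (exists v w : vert G, flag_orbit v <> flag_orbit w /\
     forall u, flag_orbit u = flag_orbit v \/ flag_orbit u = flag_orbit w) /\
  (forall d : dart G, flag_orbit (init d) <> flag_orbit (term d)).

Definition face_transitive n (G : cgraph n) (i : 'I_n) : Prop :=
  forall E F : set (vert G), is_face i E -> is_face i F ->
    exists s : aut G, s @` E = F.

Definition vertex_transitive n (G : cgraph n.+1) : Prop :=
  face_transitive G ord0.

Definition facet_transitive n (G : cgraph n.+1) : Prop :=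
  face_transitive G ord_max.

Definition trivial_facet_stabilizer n (G : cgraph n.+1) : Prop :=
  forall (F : set (vert G)) (s : aut G),
    is_face ord_max F -> s @` F = F -> s = 1%g.

(* The graph given by the involutions r_i = f i: its dart (v, i) is the one of
   color i starting at v, with inverse (f i v, i); it is a semi-edge when
   f i v = v. *)
Definition invol_graph n (V : Type) (f : 'I_n -> V -> V)
  (fK : forall i, involutive (f i)) : cgraph n.
Proof.
refine (@CGraph n V (V * 'I_n) fst (fun d => (f d.2 d.1, d.2)) _ snd _
  (fun v i => (v, i)) _ _ _) => //.
- by move=> [v i] /=; rewrite fK.
- by case.
Defined.

Section SymmetryTypeGraph.
Variables (n : nat) (G : cgraph n).

Definition orbit_type := {O : set (vert G) | exists v, O = flag_orbit v}.

Lemma r_flag_orbit i (v : vert G) : r i @` flag_orbit v = flag_orbit (r i v).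
Proof.
apply/seteqP; split=> w /=.
  by move=> [_ [s <-] <-]; exists s; rewrite iso_r.
by move=> [s <-]; exists (s v); [exists s | rewrite iso_r].
Qed.

Lemma r_orbit_subproof i (O : orbit_type) :
  exists v, r i @` (sval O) = flag_orbit v.
Proof. by have [v ->] := svalP O; exists (r i v); rewrite r_flag_orbit. Qed.

(* sends the orbit of v to the orbit of r_i v, see r_flag_orbit *)
Definition r_orbit i (O : orbit_type) : orbit_type :=
  exist _ (r i @` (sval O)) (r_orbit_subproof i O).

Lemma r_orbitK i : involutive (r_orbit i).
Proof.
case=> O pO; apply: eq_exist; have [v eO] := pO.
by rewrite /= eO !r_flag_orbit rK.
Qed.

Definition symmetry_type_graph : cgraph n := invol_graph r_orbitK.

End SymmetryTypeGraph.

Record voltage n (X : cgraph n) (gT : groupType) := Voltage {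
  volt :> dart X -> gT;
  volt_inv : forall d, volt (inv d) = ((volt d)^-1)%g
}.

Definition derived n (X : cgraph n) (gT : groupType) (xi : voltage X gT) :
  cgraph n.
Proof.
refine (@CGraph n (vert X * gT) (dart X * gT)
  (fun d => (init d.1, d.2)) (fun d => (inv d.1, (xi d.1 * d.2)%g)) _
  (fun d => color d.1) _ (fun v i => (dart_at v.1 i, v.2)) _ _ _).
- by move=> [d g] /=; rewrite invK volt_inv mulgA mulVg mul1g.
- by move=> [d g] /=; rewrite color_inv.
- by move=> [v g] i /=; rewrite init_dart_at.
- by move=> [v g] i /=; rewrite color_dart_at.
- by move=> [d g] /=; rewrite dart_at_uniq.
Defined.

(* Flags of the p-gon, with base flag y0 = (0, false): (i, false) stands for
   (r_1 r_0)^i y0 and (i, true) for r_0 (r_1 r_0)^i y0 (see pg_rotE), so that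
   the 1-face e_i consists of the flags with first component i. *)
Definition pg_flag (p : nat) : Type := ('I_p * bool)%type.

Definition pg_r0 p (y : pg_flag p) : pg_flag p := (y.1, ~~ y.2).

Definition pg_r1 p (y : pg_flag p) : pg_flag p :=
  (if y.2 then ordS y.1 else ord_pred y.1, ~~ y.2).

Definition pg_rot p (y : pg_flag p) : pg_flag p := pg_r1 (pg_r0 y).

Lemma pg_r0K p : involutive (@pg_r0 p).
Proof. by move=> [i b]; rewrite /pg_r0 /= negbK. Qed.

Lemma pg_r1K p : involutive (@pg_r1 p).
Proof. by move=> [i []]; rewrite /pg_r1 /= ?ordSK ?ord_predK. Qed.

Lemma iter_pg_rot p m (i : 'I_p) b :
  iter m (@pg_rot p) (i, b) = (iter m (if b then @ord_pred p else @ordS p) i, b).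
Proof. by elim: m => //= m ->; rewrite /pg_rot /pg_r1 /=; case: b. Qed.

Lemma iter_ordS p m (i : 'I_p) : iter m (@ordS p) i = (i + m) %% p :> nat.
Proof.
elim: m => [|m IHm]; first by rewrite addn0 modn_small.
by rewrite iterS /= IHm -addn1 modnDml addn1 addnS.
Qed.

Lemma pg_rotE p (z i : 'I_p) :
  z = 0 :> nat -> iter i (@pg_rot p) (z, false) = (i, false).
Proof.
move=> z0; rewrite iter_pg_rot; congr pair; apply: val_inj.
by rewrite /= iter_ordS z0 add0n modn_small.
Qed.

Section Family2.
Variable k : nat.

Definition fam2_r2 (y : pg_flag (4 * k)) : pg_flag (4 * k) :=
  pg_r0 (iter (2 * k) (@pg_rot (4 * k)) y).

Lemma fam2_r2K : involutive fam2_r2.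
Proof.
have SK m : cancel (iter m (@ordS (4 * k))) (iter m (@ord_pred (4 * k))).
  by elim: m => // m IHm i; rewrite iterSr iterS ordSK IHm.
have PK m : cancel (iter m (@ord_pred (4 * k))) (iter m (@ordS (4 * k))).
  by elim: m => // m IHm i; rewrite iterSr iterS ord_predK IHm.
move=> [i b]; rewrite /fam2_r2 iter_pg_rot /pg_r0 /= iter_pg_rot /= negbK.
by case: b; rewrite /= ?SK ?PK.
Qed.

Definition fam2_r (c : 'I_3) : pg_flag (4 * k) -> pg_flag (4 * k) :=
  match nat_of_ord c with
  | 0 => @pg_r0 (4 * k)
  | 1 => @pg_r1 (4 * k)
  | _ => fam2_r2
  end.

Lemma fam2_rK c : involutive (fam2_r c).
Proof.
case: c => [[|[|m]] lt_m]; rewrite /fam2_r /=.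
- exact: pg_r0K.
- exact: pg_r1K.
- exact: fam2_r2K.
Qed.

Definition family2 : cgraph 3 := invol_graph fam2_rK.

Lemma fam2_r2_edge (y : pg_flag (4 * k)) :
  (fam2_r2 y).1 = (y.1 + 2 * k) %% (4 * k) :> nat.
Proof.
have E (i : 'I_(4 * k)) : iter (2 * k) (@ordS _) (iter (2 * k) (@ordS _) i) = i.
  apply: val_inj; rewrite /= !iter_ordS modnDml -addnA -mulnDl.
  by rewrite modnDr modn_small.
case: y => i [].
  have e : fam2_r2 (iter (2 * k) (@ordS _) i, false) = (i, true).
    by rewrite /fam2_r2 iter_pg_rot /pg_r0 /= E.
  by rewrite -{1}e fam2_r2K /= iter_ordS.
by rewrite /fam2_r2 iter_pg_rot /= iter_ordS.
Qed.

Variables (gT : groupType) (tau : nat -> gT).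

(* d.1.1 is the index i of the 1-face e_i containing the initial flag of d *)
Definition fam2_volt_fun (d : dart family2) : gT :=
  let i := d.1.1 : nat in
  if color d == 2 :> nat then
    if i < 2 * k then tau i.+1 else ((tau (i - 2 * k).+1)^-1)%g
  else 1%g.

Lemma fam2_volt_fun_inv d :
  fam2_volt_fun (inv d) = ((fam2_volt_fun d)^-1)%g.
Proof.
rewrite /fam2_volt_fun color_inv; case: ifP => [/eqP c2|_]; last by rewrite invg1.
case: d c2 => [y c] /= c2.
have -> : fam2_r c y = fam2_r2 y by rewrite /fam2_r c2.
rewrite fam2_r2_edge; case: y => [[i /= lti] b].
have e4 : 4 * k = 2 * k + 2 * k by rewrite -mulnDl.
case: (ltnP i (2 * k)) => ik.
  have -> : (i + 2 * k) %% (4 * k) = i + 2 * k.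
    by rewrite modn_small // e4 ltn_add2r.
  by rewrite ltnNge leq_addl /= addnK.
have -> : (i + 2 * k) %% (4 * k) = i - 2 * k.
  rewrite -{1}(subnK ik) -addnA -e4 modnDr modn_small //.
  exact: leq_ltn_trans (leq_subr _ _) lti.
by rewrite ltn_subLR // -e4 lti invgK.
Qed.

Definition fam2_voltage : voltage family2 gT := Voltage fam2_volt_fun_inv.

End Family2.

(* Main.v *)
Require Import Defs.
From mathcomp Require Import all_boot.
From mathcomp Require Import boolp classical_sets.
From mathcomp Require Import zify.

(** The automorphism group acts freely on the flags of P, so group elements g
    are recorded by the flags Phi g.  Multiplying g on the left by a voltage
    tau_i or tau_i^-1 replaces Phi g by r_i r_0 Phi g or r_0 r_i Phi g; going
    around a vertex of the derived graph the colors i decrease cyclically, so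
    that, up to r_0, the flags Phi g follow the inverse Petrie walk of P.
    Simplicity of the Petrie polygons then says that a vertex and a facet of the
    derived graph share at most two flags, which is what the polytope axiom asks
    for.

    An automorphism of the derived graph commutes with walks, hence transports
    the relations among voltages read at a flag.  As tau_1 is the only tau_i
    that is not an involution, the automorphism induces one of four symmetries
    of the premaniplex; the two reflections among them would make tau_2 invert
    tau_1, and the nontrivial rotation would give a group automorphism inverting
    every tau_i.  Each of these contradicts the chirality of P. *)

Set Implicit Arguments.
Unset Strict Implicit.
Unset Printing Implicit Defensive.

Local Open Scope classical_set_scope.

(** * Walks and faces in edge-colored graphs *)

Section Walks.
Variables (n : nat) (G : cgraph n).
Implicit Types (v w u : vert G) (i j : 'I_n) (s t : seq 'I_n).
Implicit Types (C D : pred 'I_n).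

Lemma walk_cat v s t : walk v (s ++ t) = walk (walk v s) t.
Proof. by rewrite /walk foldl_cat. Qed.

Lemma walk_rcons v s i : walk v (rcons s i) = r i (walk v s).
Proof. by rewrite /walk foldl_rcons. Qed.

Lemma walk_rev v s : walk (walk v s) (rev s) = v.
Proof.
elim: s v => //= i s IHs v.
by rewrite rev_cons walk_rcons IHs rK.
Qed.

Lemma walk_inj s : injective (fun v => walk v s).
Proof. by move=> v w e; rewrite -(walk_rev v s) e walk_rev. Qed.

Lemma joined_refl C v : joined C v v.
Proof. by exists [::]. Qed.

Lemma joined_trans C v w u : joined C v w -> joined C w u -> joined C v u.
Proof.
move=> [s [Cs <-]] [t [Ct <-]]; exists (s ++ t).
by rewrite all_cat Cs walk_cat.
Qed.

Lemma joined_sym C v w : joined C v w -> joined C w v.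
Proof.
move=> [s [Cs <-]]; exists (rev s).
by rewrite all_rev walk_rev.
Qed.

Lemma joined_sub C D v w : {subset C <= D} -> joined C v w -> joined D v w.
Proof. by move=> CD [s [/(sub_all CD) Ds <-]]; exists s. Qed.

Lemma joined_r C i v : C i -> joined C v (r i v).
Proof. by move=> Ci; exists [:: i]; rewrite /= Ci. Qed.

Lemma joined_ind C (Q : vert G -> Prop) v w :
  (forall u i, C i -> Q u -> Q (r i u)) -> joined C v w -> Q v -> Q w.
Proof.
move=> Qr [s [Cs <-]]; elim: s v Cs => //= i s IHs v /andP[Ci Cs] Qv.
exact/IHs/Qr.
Qed.

Lemma joined_pred1 i v w : joined (pred1 i) v w -> w = v \/ w = r i v.
Proof.
move=> vw; apply: (joined_ind (Q := fun u => u = v \/ u = r i v) _ vw).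
  by move=> u j /eqP -> [->|->]; [right|left; rewrite rK].
by left.
Qed.

Lemma face_eqP i v w : face i v = face i w <-> joined (predC1 i) v w.
Proof.
split=> [e|vw].
  have : face i w w by apply: joined_refl.
  by rewrite -e.
apply/seteqP; split=> u /= h; last exact: joined_trans vw h.
exact: joined_trans (joined_sym vw) h.
Qed.

Lemma dart_eq d d' : init d = init d' :> vert G -> color d = color d' -> d = d'.
Proof. by move=> e e'; rewrite -(dart_at_uniq d) e e' dart_at_uniq. Qed.

Lemma r_comm i j v : premaniplex G -> (i.+1 < j) || (j.+1 < i) ->
  r i (r j v) = r j (r i v).
Proof. by move=> [_ /[apply] /(_ v) /= {1}<-]; rewrite !rK. Qed.

Lemma simple_r_neq i v : simple_graph G -> r i v <> v.
Proof. by move=> [+ _]; move=> /(_ (dart_at v i)); rewrite init_dart_at. Qed.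

Lemma simple_r_inj i j v : simple_graph G -> r i v = r j v -> i = j.
Proof.
move=> [_ /(_ (dart_at v i) (dart_at v j))].
rewrite !init_dart_at => /(_ erefl) h /h e.
by rewrite -(color_dart_at v i) e color_dart_at.
Qed.

(** Otherwise the intersection condition with [m = i] and [k = i + 1] gives a path without colors,
    so r_i v = v. If i is the last color, the given path is itself empty. *)
Lemma polytope_not_above i v :
  polytope G -> ~ joined (fun c : 'I_n => i < c) v (r i v).
Proof.
move=> [[_ simpleG] inter] above.
suff [[|c s] [s0 /= e]] : joined (fun c : 'I_n => i < c <= i) v (r i v).
- exact: simple_r_neq simpleG (esym e).
- by move: s0 => /= /andP[]; rewrite ltnNge; case: (c <= i).
case: (ltnP i.+1 n) => [lt_in|le_ni].
  apply: (inter i (Ordinal lt_in)) => //.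
  by apply: joined_r.
move: above => [[|c s] [/= lt_s e]].
  by exists [::].
by exfalso; move: lt_s (ltn_ord c); lia.
Qed.

End Walks.

(** * Isomorphisms as bijections of flags *)

Section Isomorphisms.
Variables (n : nat) (G H : cgraph n).

Lemma iso_walk (f : iso G H) v s : f (walk v s) = walk (f v) s.
Proof. by elim: s v => //= i s IHs v; rewrite IHs iso_r. Qed.

Lemma iso_joined (f : iso G H) C v w : joined C v w -> joined C (f v) (f w).
Proof. by move=> [s [Cs <-]]; exists s; rewrite iso_walk. Qed.

Lemma iso_of_bij (f : vert G -> vert H) (g : vert H -> vert G) :
  cancel f g -> cancel g f -> (forall i v, f (r i v) = r i (f v)) ->
  exists F : iso G H, iso_vert F = f.
Proof.
move=> fK gK f_r.
have g_r i w : g (r i w) = r i (g w).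
  by apply: (can_inj fK); rewrite f_r !gK.
pose fd (d : dart G) := dart_at (f (init d)) (color d).
pose gd (d : dart H) := dart_at (g (init d)) (color d).
have rE (K : cgraph n) (d : dart K) : term d = r (color d) (init d).
  by rewrite /r dart_at_uniq.
refine (ex_intro _ (@Iso n G H f fd g gd fK gK _ _ _ _ _) erefl).
- by move=> d; rewrite /fd /gd init_dart_at color_dart_at fK dart_at_uniq.
- by move=> d; rewrite /fd /gd init_dart_at color_dart_at gK dart_at_uniq.
- by move=> d; rewrite /fd init_dart_at.
- move=> d; apply: dart_eq; last by rewrite /fd !color_inv !color_dart_at.
  rewrite {2}/fd init_dart_at -!/(term _) !rE /fd.
  by rewrite init_dart_at color_dart_at f_r.
- by move=> d; rewrite /fd color_dart_at.
Qed.

End Isomorphisms.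

(** * Automorphisms and flag orbits *)

Section Automorphisms.
Variables (n : nat) (G : cgraph n).
Implicit Types (v w : vert G) (i : 'I_n) (s t : aut G).

Lemma aut_eq_at v s t : connected G -> s v = t v -> s = t.
Proof.
move=> [_ conn] e; apply: autP => w; have [c [_ <-]] := conn v w.
by rewrite !iso_walk e.
Qed.

Lemma autME s t v : (s * t)%g v = t (s v).
Proof. by []. Qed.

Lemma aut1E v : (1%g : aut G) v = v.
Proof. by []. Qed.

Lemma autVK s v : (s^-1)%g (s v) = v.
Proof. exact: iso_vertK. Qed.

Lemma autKV s v : s ((s^-1)%g v) = v.
Proof. exact: iso_vert_invK. Qed.

Lemma image_face s i v : s @` face i v = face i (s v).
Proof.
apply/seteqP; split=> w /=; first by move=> [u vu <-]; apply: iso_joined.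
move=> svw; exists ((s^-1)%g w); last exact: autKV.
by have := iso_joined (s^-1)%g svw; rewrite autVK.
Qed.

Lemma flag_orbit_eqP v w :
  flag_orbit v = flag_orbit w <-> exists s : aut G, s v = w.
Proof.
split=> [e|[s <-]].
  have : flag_orbit w w by exists 1%g.
  by rewrite -e.
apply/seteqP; split=> u /= [t <-]; last by exists (s * t)%g.
by exists (s^-1 * t)%g; rewrite autME autVK.
Qed.

(* The witness f need not be assumed bijective: f (f v) = v already holds. *)
Lemma closed_walks_aut v i : connected G ->
  (forall c, walk v c = v -> walk (r i v) c = r i v) ->
  exists t : aut G, t v = r i v.
Proof.
move=> [inh conn] closed.
have [c cE] : exists c : vert G -> seq 'I_n, forall w, walk v (c w) = w.
  suff /choice[c cE] : forall w, exists p, walk v p = w by exists c.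
  move=> w.
  by have [p [_ e]] := conn v w; exists p.
pose f w := walk (r i v) (c w).
(* Two paths from v to one flag differ by a closed walk, so [f] does not depend on the choice of
   [c]. *)
have f_walk p : f (walk v p) = walk (r i v) p.
  apply: (@walk_inj _ _ (rev p)); rewrite walk_rev /f -walk_cat closed //.
  by rewrite walk_cat cE walk_rev.
have f_r j w : f (r j w) = r j (f w).
  by rewrite -{1}(cE w) -walk_rcons f_walk walk_rcons.
have fK : involutive f.
  move=> w; rewrite -{1}(cE w) f_walk.
  have -> : r i v = walk v [:: i] by [].
  rewrite -walk_cat f_walk walk_cat -[walk _ [:: i]]/(r i (r i v)) rK.
  exact: cE.
have [t tE] := iso_of_bij fK fK f_r.
by exists t; rewrite tE (f_walk [::]).
Qed.

End Automorphisms.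

(** * Partial Petrie steps and simple Petrie polygons *)

Section Petrie.
Variables (n : nat) (G : cgraph n.+1).
Implicit Types (u v w : vert G).

(** Colors become natural numbers; [inord] sends those above n to 0, whence the range hypotheses
    below. *)
Definition rn (j : nat) v : vert G := r (inord j) v.

Definition run (a m : nat) v : vert G := walk v [seq inord c | c <- iota a m].

(** The final part r_n ... r_a of a Petrie step, the identity for a = n + 1. *)
Definition up (a : nat) v : vert G := run a (n.+1 - a) v.

Lemma rnK j : involutive (rn j).
Proof. exact: rK. Qed.

Lemma r_rn (i : 'I_n.+1) v : r i v = rn i v.
Proof. by rewrite /rn inord_val. Qed.

Lemma rn0 v : rn 0 v = r ord0 v.
Proof. by congr r; apply: val_inj; rewrite /= inordK. Qed.

Lemma runS a m v : run a m.+1 v = run a.+1 m (rn a v).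
Proof. by []. Qed.

Lemma run_cat a m m' v : run a (m + m') v = run (a + m) m' (run a m v).
Proof. by rewrite /run iotaD map_cat walk_cat. Qed.

Lemma up_split a b v : a <= b <= n.+1 -> up a v = up b (run a (b - a) v).
Proof.
move=> /andP[ab bn]; rewrite /up.
have -> : n.+1 - a = (b - a) + (n.+1 - b) by lia.
by rewrite run_cat subnKC.
Qed.

Lemma upS a v : a <= n -> up a v = up a.+1 (rn a v).
Proof. by move=> an; rewrite (@up_split a a.+1) ?leqnSn // subSnn. Qed.

Lemma up_last v : up n.+1 v = v.
Proof. by rewrite /up subnn. Qed.

Lemma up_inj a : injective (up a).
Proof. exact: walk_inj. Qed.

Lemma petrie_stepE v : petrie_step v = up 0 v.
Proof.
rewrite /petrie_step /up /run subn0; congr walk.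
rewrite -val_enum_ord -map_comp -[LHS]map_id.
by apply: eq_map => i; rewrite /= inord_val.
Qed.

Lemma petrie_step_inj : injective (@petrie_step _ G).
Proof. exact: walk_inj. Qed.

Lemma all_run b a m : b <= a -> a + m <= n.+1 ->
  all (fun c : 'I_n.+1 => b <= c) [seq inord c | c <- iota a m].
Proof.
move=> ba am; rewrite all_map; apply/allP => c; rewrite mem_iota => /andP[ac cm].
by rewrite /= inordK ?(leq_trans ba) // (leq_trans cm).
Qed.

Lemma joined_run b a m v : b <= a -> a + m <= n.+1 ->
  joined (fun c : 'I_n.+1 => b <= c) v (run a m v).
Proof. by move=> ba am; exists [seq inord c | c <- iota a m]; rewrite all_run. Qed.

Lemma joined_up b a v : b <= a -> a <= n.+1 ->
  joined (fun c : 'I_n.+1 => b <= c) v (up a v).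
Proof. by move=> ba an; apply: joined_run => //; rewrite subnKC. Qed.

Lemma walk_r0 s v : premaniplex G -> all (fun c : 'I_n.+1 => 2 <= c) s ->
  walk (rn 0 v) s = rn 0 (walk v s).
Proof.
move=> preG; elim: s v => //= i s IHs v /andP[i2 /IHs <-].
by rewrite /rn r_comm // inordK // i2 orbT.
Qed.

Lemma up_r0 a v : premaniplex G -> 2 <= a <= n.+1 ->
  up a (rn 0 v) = rn 0 (up a v).
Proof.
by move=> preG /andP[a2 an]; rewrite /up /run walk_r0 // all_run // subnKC.
Qed.

Lemma joined_r0 v w : premaniplex G ->
  joined (fun c : 'I_n.+1 => 2 <= c) v w ->
  joined (fun c : 'I_n.+1 => 2 <= c) (rn 0 v) (rn 0 w).
Proof. by move=> preG [s [s2 <-]]; exists s; rewrite walk_r0. Qed.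

Lemma petrie_polygonS u v :
  petrie_polygon u v -> petrie_polygon u (petrie_step v).
Proof.
move=> [[|m] [<-|e]].
- by exists 1; left.
- by exists 1; left; rewrite -e.
- by exists m.+2; left.
- by exists m; right; rewrite -e iterSr.
Qed.

Lemma petrie_polygon_pred u v :
  petrie_polygon u (petrie_step v) -> petrie_polygon u v.
Proof.
move=> [[|m] [e|e]].
- by exists 1; right.
- by exists 1; right.
- by exists m; left; apply: petrie_step_inj.
- by exists m.+2; right; rewrite iterSr.
Qed.

Lemma polytope_rn_not_above j v : polytope G -> j <= n ->
  ~ joined (fun c : 'I_n.+1 => j < c) v (rn j v).
Proof.
by move=> pG jn; have := @polytope_not_above _ _ (inord j) v pG; rewrite inordK.
Qed.

(** If a < b, cancelling [up b] leaves a closed run through the colors a, ..., b - 1, which joins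
    r_a v to v by colors above a. *)
Lemma up_eq a b v : polytope G -> a <= n.+1 -> b <= n.+1 ->
  up a v = up b v -> a = b.
Proof.
move=> pG; wlog ab : a b / a < b => [hw an bn e|].
  case: (ltngtP a b) => // ab; first exact: hw.
  by apply/esym/hw.
move=> an bn e; exfalso; apply: (@polytope_rn_not_above a v pG); first lia.
have {}e : run a (b - a) v = v.
  by apply: (@up_inj b); rewrite -up_split // bn ltnW.
apply: joined_sym; rewrite -{2}e -(subnSK ab) runS.
by apply: joined_run => //; lia.
Qed.

Hypotheses (pG : polytope G) (petrieG : simple_petrie_polygons G).

Let preG : premaniplex G := pG.1.1.

Lemma petrie_eq u v w : petrie_polygon u v -> petrie_polygon u w ->
  joined (fun c : 'I_n.+1 => 0 < c) v w -> v = w.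
Proof.
move=> uv uw vw; case: (EM (v = w)) => // /(petrieG uv uw) []; apply/face_eqP.
by apply: joined_sub vw => i; rewrite !unfold_in /= -val_eqE /= lt0n.
Qed.

(* Both ends of each [up a v] with 0 < a lie in one vertex, so simplicity of the
   Petrie polygon identifies the two flags of it. *)
Lemma petrie_up_eq u v a b : 0 < a <= n.+1 -> 0 < b <= n.+1 ->
  petrie_polygon u (up a v) -> petrie_polygon u (up b v) -> a = b.
Proof.
move=> /andP[a1 an] /andP[b1 bn] ua ub; apply: (@up_eq a b v) => //.
apply: petrie_eq ua ub _.
by apply: joined_trans (joined_up _ b1 bn); apply/joined_sym/joined_up.
Qed.

(** With w = [up b v], the Petrie step of r_0 w is [up 1 w], which lies in the vertex of [up a v].
    Simplicity makes them equal, and then r_1 w is joined to w by colors at least 2. *)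
Lemma petrie_up_r0 u v a b : 2 <= a <= n.+1 -> 2 <= b <= n.+1 ->
  petrie_polygon u (up a v) -> ~ petrie_polygon u (up b (rn 0 v)).
Proof.
move=> /andP[a2 an] /andP[b2 bn] ua.
rewrite up_r0 ?b2 // => /petrie_polygonS; rewrite petrie_stepE upS // rnK.
set w := up b v => uw.
have e : up a v = up 1 w.
  apply: petrie_eq ua uw _; apply: joined_trans (joined_up _ _ _) => //.
  apply: joined_trans (joined_up _ _ _) => //; last exact: ltnW.
  by apply/joined_sym/joined_up => //; apply: ltnW.
have {}e : v = run 2 (a - 2) (rn 1 w).
  by apply: (@up_inj a); rewrite e upS ?(@up_split 2 a) ?a2 //; lia.
apply: (@polytope_rn_not_above 1 w pG); first lia.
apply: joined_sym; apply: joined_trans (joined_up _ b2 bn).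
by rewrite [X in joined _ _ X]e; apply: joined_run => //; lia.
Qed.

End Petrie.

(** * The two flag orbits of a chiral graph *)

Section ChiralOrbits.
Variables (n : nat) (G : cgraph n).
Hypothesis chiralG : chiral G.
Implicit Types (v : vert G) (i j : 'I_n).

Lemma chiral_r_orbit i v : flag_orbit (r i v) <> flag_orbit v.
Proof.
by move=> e; case: (chiralG.2 (dart_at v i)); rewrite init_dart_at -/(r i v) e.
Qed.

Lemma chiral_aut_neq i v (t : aut G) : t v <> r i v.
Proof.
by move=> e; case: (@chiral_r_orbit i v); apply/esym/flag_orbit_eqP; exists t.
Qed.

(** Each adjacency changes the orbit, and there are only two orbits. *)
Lemma chiral_rotation i j v : exists t : aut G, t v = r i (r j v).
Proof.
apply/flag_orbit_eqP; have [[u [w [_ two]]] _] := chiralG.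
have := @chiral_r_orbit i (r j v); have := @chiral_r_orbit j v.
by case: (two v) (two (r j v)) (two (r i (r j v))) => [->|->] [->|->] [->|->].
Qed.

End ChiralOrbits.

(** * The rotation group of a chiral polytope *)

Section Rotations.
Variables (n : nat) (G : cgraph n.+1) (Phi : vert G) (tau : nat -> aut G).
Hypotheses (pG : polytope G) (chiralG : chiral G).
Hypothesis tauE : forall j, 0 < j <= n -> tau j Phi = rn j (rn 0 Phi).
Implicit Types (v : vert G) (g h x : aut G) (j : nat).

Let preG : premaniplex G := pG.1.1.
Let connG : connected G := preG.1.

Lemma aut_rn g j v : g (rn j v) = rn j (g v).
Proof. exact: iso_r. Qed.

Lemma aut_neq_rn j g v : g v <> rn j v.
Proof. exact: chiral_aut_neq. Qed.

Lemma aut_inj_at g h : g Phi = h Phi -> g = h.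
Proof. exact: aut_eq_at. Qed.

Lemma tauM j g : 0 < j <= n -> (tau j * g)%g Phi = rn j (rn 0 (g Phi)).
Proof. by move=> jn; rewrite autME tauE // !aut_rn. Qed.

Lemma tauVM j g : 0 < j <= n -> ((tau j)^-1 * g)%g Phi = rn 0 (rn j (g Phi)).
Proof.
move=> jn; rewrite autME; suff -> : (tau j)^-1%g Phi = rn 0 (rn j Phi).
  by rewrite !aut_rn.
by rewrite -[RHS](autVK (tau j)) !(aut_rn (tau j)) tauE // !rnK.
Qed.

Lemma rn_comm0 j v : 2 <= j <= n -> rn 0 (rn j v) = rn j (rn 0 v).
Proof.
by move=> /andP[j2 jn]; apply: r_comm => //; rewrite !inordK ?j2.
Qed.

Lemma tau_invol j : 2 <= j <= n -> (tau j * tau j = 1)%g.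
Proof.
move=> jn; apply: aut_inj_at; rewrite tauM ?tauE; [|lia..].
by rewrite -rn_comm0 // !rnK.
Qed.

Lemma tauV j : 2 <= j <= n -> (tau j)^-1%g = tau j.
Proof. by move=> /tau_invol/mulg1_eq. Qed.

(* The relation plays the part of a homomorphism inverting every generator,
   that is, of conjugation by a reflection fixing all of the base flag but its
   vertex. *)
Definition inverts_tau (T : aut G -> aut G -> Prop) :=
  T 1%g 1%g /\ forall j g h, 0 < j <= n -> T g h ->
    T (tau j * g)%g ((tau j)^-1 * h)%g /\ T ((tau j)^-1 * g)%g (tau j * h)%g.

(** A walk from [Phi] spells a word in the tau_i, up to a final r_0; started at r_0 Phi it spells
    the word with every letter inverted. *)
Lemma walk_inverts T : inverts_tau T -> forall s : seq 'I_n.+1,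
  exists g h, T g h /\
    ((walk Phi s = g Phi /\ walk (rn 0 Phi) s = rn 0 (h Phi)) \/
     (walk Phi s = rn 0 (g Phi) /\ walk (rn 0 Phi) s = h Phi)).
Proof.
move=> [T1 TS]; elim/last_ind => [|s i [g [h [Tgh IH]]]].
  by exists 1%g, 1%g; split=> //; left.
rewrite !walk_rcons !r_rn.
have [i0|i_gt0] := posnP i.
  exists g, h; split=> //; rewrite i0.
  by case: IH => -[-> ->]; [right|left]; rewrite rnK.
have i_n : 0 < i <= n by rewrite i_gt0 -ltnS ltn_ord.
have [T_ T_V] := TS _ _ _ i_n Tgh.
case: IH => -[-> ->].
  exists ((tau i)^-1 * g)%g, (tau i * h)%g; split=> //; right.
  by split; rewrite (tauM, tauVM) ?rnK.
exists (tau i * g)%g, ((tau i)^-1 * h)%g; split=> //; left.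
by split; rewrite (tauM, tauVM) ?rnK.
Qed.

Lemma tau_ind (Q : aut G -> Prop) : Q 1%g ->
  (forall j g, 0 < j <= n -> Q g -> Q (tau j * g)%g /\ Q ((tau j)^-1 * g)%g) ->
  forall g, Q g.
Proof.
move=> Q1 QS g; have QT : inverts_tau (fun x _ => Q x).
  by split=> // j x _ jn /(QS _ _ jn).
have [s [_ sE]] := connG.2 Phi (g Phi).
have [x [_ [genx [[e _]|[e _]]]]] := walk_inverts QT s.
  by rewrite (@aut_inj_at g x) // -e.
case: (@aut_neq_rn 0 (g * x^-1)%g Phi).
by rewrite autME -sE e aut_rn autVK.
Qed.

Lemma generated_tau g :
  generated (fun t : aut G => exists i, 0 < i <= n /\ t = tau i) g.
Proof.
apply: tau_ind g => [|j x jn genx]; first exact: gen_1.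
have genj : generated (fun t : aut G => exists i, 0 < i <= n /\ t = tau i) (tau j).
  by apply: gen_in; exists j.
by split; apply: gen_mul => //; apply: gen_inv.
Qed.

(** If 1 were related to 1 only, walks closed at [Phi] would be closed at r_0 Phi, and
    [closed_walks_aut] would move [Phi] to its neighbor. *)
Lemma chiral_no_inversion T :
  inverts_tau T -> ~ (forall h, T 1%g h -> h = 1%g).
Proof.
move=> invT T1.
suff [t tE] : exists t : aut G, t Phi = rn 0 Phi.
  exact: aut_neq_rn tE.
apply: closed_walks_aut => // s.
have [g [h [Tgh [[-> ->]|[-> _]]]]] := walk_inverts invT s.
  move=> g1; have {}g1 : g = 1%g by apply: aut_inj_at.
  by rewrite g1 in Tgh; rewrite (T1 _ Tgh).
move=> /(congr1 (rn 0)); rewrite rnK => e.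
by case: (aut_neq_rn e).
Qed.

(** Otherwise all generators are involutions and equality inverts them. *)
Lemma tau1_not_invol : (tau 1 * tau 1 <> 1)%g.
Proof.
move=> t11; have tV j : 0 < j <= n -> (tau j)^-1%g = tau j.
  move=> jn; have [j1|j1] := leqP j 1; last by rewrite tauV // j1; case/andP: jn.
  have -> : j = 1 by lia.
  exact: mulg1_eq.
apply: (@chiral_no_inversion eq) => //; split=> // j g _ jn <-.
by rewrite tV.
Qed.

Lemma tau1_conj j : 3 <= j <= n -> (tau j * tau 1 = (tau 1)^-1 * tau j)%g.
Proof.
move=> jn; apply: aut_inj_at; rewrite tauM ?tauVM ?tauE; [|lia..].
have c v : rn 1 (rn j v) = rn j (rn 1 v).
  by apply: r_comm => //; rewrite !inordK; lia.
by rewrite c (@rn_comm0 j) //; lia.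
Qed.

Lemma tau1_tau_invol j : 3 <= j <= n ->
  (tau 1 * tau j * tau 1 * tau j = 1)%g.
Proof.
move=> jn; rewrite -!mulgA (mulgA (tau j)) tau1_conj // -mulgA.
by rewrite tau_invol ?mulg1 ?mulgV //; lia.
Qed.

(* If tau 2 inverts tau 1, then the group is the semidirect product of
   <tau 1> by <tau 2, ..., tau n>, each generator of the latter inverting
   tau 1; hence a x |-> a^-1 x inverts all generators. *)
Lemma tau2_not_inverts_tau1 : 2 <= n -> (tau 2 * tau 1 <> (tau 1)^-1 * tau 2)%g.
Proof.
move=> n2 t21.
have tj1 j : 2 <= j <= n -> (tau j * tau 1 = (tau 1)^-1 * tau j)%g.
  move=> jn; have [j2|j2] := leqP j 2; last by apply: tau1_conj; lia.
  by have -> : j = 2 by lia.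
have tj1V j : 2 <= j <= n -> (tau j * (tau 1)^-1 = tau 1 * tau j)%g.
  move=> jn; apply: (@mulIg _ (tau 1)); rewrite mulgVK -mulgA tj1 //.
  by rewrite mulVKg.
(* [low] and [high] keep the needed properties of <tau_1> and <tau_2, ..., tau_n>; the latter moves
   [Phi], up to r_0, by colors at least 2. *)
pose low a := [/\ (a * tau 1 = tau 1 * a)%g,
  forall j, 2 <= j <= n -> (tau j * a = a^-1 * tau j)%g &
  joined (fun c : 'I_n.+1 => c <= 1) Phi (a Phi)].
pose high x := joined (fun c : 'I_n.+1 => 2 <= c) Phi (x Phi) \/
  joined (fun c : 'I_n.+1 => 2 <= c) (rn 0 Phi) (x Phi).
have low1 : low 1%g.
  split; rewrite ?mul1g ?mulg1 ?invg1 //; last exact: joined_refl.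
  by move=> j _; rewrite mul1g mulg1.
have low_join j v : j <= 1 -> joined (fun c : 'I_n.+1 => c <= 1) Phi v ->
    joined (fun c : 'I_n.+1 => c <= 1) Phi (rn j v).
  by move=> j1 /joined_trans; apply; apply: joined_r; rewrite inordK //; lia.
have lowM a : low a -> low (tau 1 * a)%g /\ low ((tau 1)^-1 * a)%g.
  move=> [c ja jl].
  have cV : (a * (tau 1)^-1 = (tau 1)^-1 * a)%g.
    by apply: (@mulIg _ (tau 1)); rewrite mulgVK -mulgA c mulKg.
  split; split.
  - by rewrite -mulgA c.
  - by move=> j jn; rewrite -[in RHS]c invgM mulgA tj1 // -!mulgA ja.
  - by rewrite tauM; [do 2!apply/low_join => //|lia].
  - by rewrite -mulgA c mulKg mulVKg.
  - by move=> j jn; rewrite -[in RHS]cV invgM invgK mulgA tj1V // -!mulgA ja.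
  - by rewrite tauVM; [do 2!apply/low_join => //|lia].
have lowV a : low a -> low (a^-1)%g.
  move=> [c ja jl]; split.
  - by apply: (@mulgI _ a); rewrite mulVKg mulgA c mulgK.
  - move=> j jn; rewrite invgK; apply: (@mulIg _ a).
    by rewrite mulgVK -mulgA ja // mulVKg.
  - by apply: joined_sym; have := iso_joined (a^-1)%g jl; rewrite autVK.
have highM j x : 2 <= j <= n -> high x -> high (tau j * x)%g.
  move=> jn hx; rewrite /high tauM; last lia.
  have step v w : joined (fun c : 'I_n.+1 => 2 <= c) v w ->
      joined (fun c : 'I_n.+1 => 2 <= c) (rn 0 v) (rn j (rn 0 w)).
    move=> /(joined_r0 preG)/joined_trans; apply; apply: joined_r.
    by rewrite inordK; lia.
  by case: hx => [/step|/step]; rewrite ?rnK; [right|left].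
pose T g h := exists a x, [/\ low a, high x, g = (a * x)%g & h = (a^-1 * x)%g].
apply: (@chiral_no_inversion T).
  split.
    exists 1%g, 1%g; split; rewrite ?mulg1 ?invg1 //; left; exact: joined_refl.
  move=> j g h jn [a [x [la hx -> ->]]]; have [la1 la1V] := lowM a la.
  have [ca aj _] := la.
  have [j1|j1] := leqP j 1.
    have -> : j = 1 by lia.
    split; [exists (tau 1 * a)%g, x | exists ((tau 1)^-1 * a)%g, x]; split => //.
    - by rewrite mulgA.
    - by rewrite -ca invgM mulgA.
    - by rewrite mulgA.
    - by have [cV _ _] := lowV _ la; rewrite invgM invgK mulgA cV.
  have jn2 : 2 <= j <= n by lia.
  have [_ ajV _] := lowV _ la.
  rewrite tauV // !mulgA aj // ajV // invgK -!mulgA.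
  by split; exists (a^-1)%g, (tau j * x)%g; split; rewrite ?invgK //; auto.
(* The two subgroups meet trivially: no color is both at most 1 and at least 2, and chirality
   excludes x Phi = r_0 Phi. *)
move=> h [a [x [[_ _ la] hx e ->]]].
have ex : x = (a^-1)%g by rewrite -(mulKg a x) -e mulg1.
have lx : joined (fun c : 'I_n.+1 => c <= 1) (x Phi) Phi.
  by have := iso_joined x la; rewrite -autME -e.
suff x1 : x = 1%g by rewrite -ex x1 mulg1.
have inter v : joined (fun c : 'I_n.+1 => c <= 1) (x Phi) v ->
    joined (fun c : 'I_n.+1 => 2 <= c) v (x Phi) -> x Phi = v.
  move=> lv hv; have [||c [lt_c cE]] := pG.2 (inord 1) (inord 2) (x Phi) v.
  - by rewrite inordK //; lia.
  - by apply: joined_sym; rewrite inordK //; lia.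
  by case: c lt_c cE => //= c s; rewrite !inordK; lia.
case: hx => [|/inter] hx; first exact/aut_inj_at/inter.
case: (@aut_neq_rn 0 x Phi); apply: hx.
by apply: joined_trans lx _; apply: joined_r; rewrite inordK.
Qed.

End Rotations.

(** * Translations of a derived graph *)

Section Translations.
Variables (n : nat) (X : cgraph n) (gT : groupType) (xi : voltage X gT).

Lemma derived_rE i y (g : gT) :
  r i ((y, g) : vert (derived xi)) = (r i y, (xi (dart_at y i) * g)%g).
Proof. by []. Qed.

(** Voltages multiply on the left, so right multiplication commutes with every r_i. *)
Lemma derived_translation (h : gT) :
  exists s : aut (derived xi), forall x, s x = (x.1, (x.2 * h)%g).
Proof.
have [||i [y g]|s sE] := @iso_of_bij _ (derived xi) (derived xi)
  (fun x => (x.1, (x.2 * h)%g)) (fun x => (x.1, (x.2 * h^-1)%g)).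
- by move=> [y g] /=; rewrite mulgK.
- by move=> [y g] /=; rewrite mulgVK.
- by rewrite !derived_rE /= mulgA.
- by exists s => x; rewrite sE.
Qed.

End Translations.

Lemma val_ord_pred p (i : 'I_p) :
  ord_pred i = (if i == 0 :> nat then p.-1 else i.-1) :> nat.
Proof.
case: i => [[|i] lt_ip] /=; first by rewrite modn_small // ltn_predL.
by rewrite modnDr modn_small // ltnW.
Qed.

Lemma iter_ord_predK p m (i : 'I_p) : iter m (@ord_pred p) (iter m (@ordS p) i) = i.
Proof. by elim: m i => // m IHm i; rewrite iterSr iterS ordSK IHm. Qed.

(** * Vertices of the derived graph and Petrie walks of [P] *)

Section DerivedFamily2.
Variables (k : nat) (P : cgraph (2 * k).+1) (Phi : vert P) (tau : nat -> aut P).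
Hypotheses (k_ge2 : 2 <= k) (polyP : polytope P) (chiralP : chiral P).
Hypothesis petrieP : simple_petrie_polygons P.
Hypothesis tauE : forall j, 0 < j <= 2 * k -> tau j Phi = rn j (rn 0 Phi).

Local Notation X := (family2 k).
Local Notation Y := (derived (fam2_voltage k tau)).
Local Notation flag := (pg_flag (4 * k)).
Implicit Types (y : flag) (x : vert Y) (g h : aut P).

Definition vol (i : nat) : aut P :=
  if i < 2 * k then tau i.+1 else ((tau (i - 2 * k).+1)^-1)%g.

Lemma color3 (c : 'I_3) : [\/ c = inord 0, c = inord 1 | c = inord 2].
Proof.
case: c => [[|[|[|//]]] lt_c]; [apply: Or31|apply: Or32|apply: Or33];
  by apply: val_inj; rewrite /= inordK.
Qed.

Lemma derived_r0 y g : rn 0 ((y, g) : vert Y) = (pg_r0 y, g).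
Proof.
rewrite /rn derived_rE /= /fam2_volt_fun /= inordK // mul1g.
by rewrite /r /term /= /fam2_r inordK.
Qed.

Lemma derived_r1 y g : rn 1 ((y, g) : vert Y) = (pg_r1 y, g).
Proof.
rewrite /rn derived_rE /= /fam2_volt_fun /= inordK // mul1g.
by rewrite /r /term /= /fam2_r inordK.
Qed.

Lemma derived_r2 y g : rn 2 ((y, g) : vert Y) = (fam2_r2 y, (vol y.1 * g)%g).
Proof.
rewrite /rn derived_rE /= /fam2_volt_fun /= inordK //.
by rewrite /r /term /= /fam2_r inordK.
Qed.

Lemma fam2_r2_side y : (fam2_r2 y).2 = ~~ y.2.
Proof. by case: y => i b; rewrite /fam2_r2 iter_pg_rot. Qed.

Lemma opposite_edge i : i < 4 * k ->
  (i + 2 * k) %% (4 * k) = if i < 2 * k then i + 2 * k else i - 2 * k.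
Proof.
move=> lti; case: ltnP => ik; first by rewrite modn_small //; lia.
rewrite -{1}(subnK ik) -addnA -mulnDl modnDr modn_small //; lia.
Qed.

(* Each pair {(i, true), (i + 1, false)} of flags of X interchanged by r_1 is
   named by the 1-face e_i containing the first of them. *)
Definition corner y : 'I_(4 * k) := if y.2 then y.1 else ord_pred y.1.

Lemma corner_r1 y : corner (pg_r1 y) = corner y.
Proof. by case: y => i []; rewrite /corner /= ?ordSK. Qed.

Lemma corner_eq y y' : corner y = corner y' -> y' = y \/ y' = pg_r1 y.
Proof.
case: y y' => i [] [i' []]; rewrite /corner /= => e.
- by left; rewrite e.
- by right; rewrite /pg_r1 /= e ord_predK.
- by right; rewrite /pg_r1 /= e.
- by left; rewrite -(ord_predK i') -e ord_predK.
Qed.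

Lemma corner_r2 (i : 'I_(4 * k)) :
  corner (fam2_r2 (i, true)) = (if i < 2 * k then i + 2 * k - 1
    else if i == 2 * k :> nat then 4 * k - 1 else i - 2 * k - 1) :> nat.
Proof.
rewrite /corner fam2_r2_side val_ord_pred fam2_r2_edge opposite_edge //=.
have := ltn_ord i; case: (ltnP i (2 * k)) => ik; case: eqP; try case: eqP; lia.
Qed.

(** With i taken modulo 2k, the colors i + 2, ..., 2k are those undone since the last full period;
    [up] puts them back. The half of the polygon decides whether the current flag is r_0 g Phi or g
    Phi. *)
Definition corner_petrie (i : nat) g : vert P :=
  if i < 2 * k then up i.+2 (rn 0 (g Phi)) else up (i - 2 * k).+2 (g Phi).

(* Going around a vertex of Y with r_1 r_2, each step multiplies the group
   element by the voltage of the color 2 dart.  On the corresponding flag of P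
   this applies, up to r_0, the next color of the inverse Petrie walk, and
   [petrie_flag] recovers the last flag of P at which that walk closed a period. *)
Definition petrie_flag x : vert P := corner_petrie (corner x.1) x.2.

Lemma petrie_flag_r1 x : petrie_flag (rn 1 x) = petrie_flag x.
Proof. by case: x => y g; rewrite derived_r1 /petrie_flag /= corner_r1. Qed.

Let tau_at j g : 0 < j <= 2 * k -> g (tau j Phi) = rn j (rn 0 (g Phi)).
Proof. exact: tauM. Qed.

Let tauV_at j g : 0 < j <= 2 * k -> g ((tau j)^-1%g Phi) = rn 0 (rn j (g Phi)).
Proof. exact: tauVM. Qed.

(** The voltage undoes the next color, which [up] then puts back. Only at e_0 and e_2k are colors 1
    and 0 undone together, which completes a period and moves the flag back one Petrie step. *)
Lemma petrie_flag_r2 (i : 'I_(4 * k)) g :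
  let x := ((i, true), g) : vert Y in
  petrie_flag (rn 2 x) = petrie_flag x \/
  petrie_step (petrie_flag (rn 2 x)) = petrie_flag x.
Proof.
move=> x; rewrite {}/x derived_r2 /petrie_flag /corner_petrie corner_r2 /=.
rewrite petrie_stepE /vol /=.
have i4k := ltn_ord i; case: (ltnP i (2 * k)) => ik.
  have [i0|i_gt0] := posnP i.
    right; rewrite i0 add0n.
    have -> : 2 * k - 1 < 2 * k by lia.
    have -> : (2 * k - 1).+2 = (2 * k).+1 by lia.
    rewrite up_last tau_at //; last lia.
    by rewrite upS // upS ?rnK //; lia.
  left; have -> : (i + 2 * k - 1 < 2 * k) = false by lia.
  have -> : (i + 2 * k - 1 - 2 * k).+2 = i.+1 by lia.
  by rewrite tau_at 1?upS ?rnK //; lia.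
case: eqP => [i2k|ni2k].
  right; have -> : (4 * k - 1 < 2 * k) = false by lia.
  have -> : (4 * k - 1 - 2 * k).+2 = (2 * k).+1 by lia.
  rewrite up_last tauV_at; last lia.
  by rewrite i2k subnn upS // upS ?rnK //; lia.
left; have -> : i - 2 * k - 1 < 2 * k by lia.
have -> : (i - 2 * k - 1).+2 = (i - 2 * k).+1 by lia.
by rewrite tauV_at ?rnK 1?upS ?rnK //; lia.
Qed.

Lemma petrie_polygon_corner u x c : 0 < c < 3 ->
  petrie_polygon u (petrie_flag x) -> petrie_polygon u (petrie_flag (rn c x)).
Proof.
case: c => [|[|[|//]]] // _; first by rewrite petrie_flag_r1.
case: x => [[i []] g] ux.
  by case: (petrie_flag_r2 i g) => [->|e] //; apply: petrie_polygon_pred; rewrite e.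
(* The flag (i, false) is the r_2-neighbor of one with side [true], so [petrie_flag_r2] is used
   backwards. *)
have [j jE] : exists j, fam2_r2 (i, false) = (j, true).
  by exists (fam2_r2 (i, false)).1; rewrite [LHS]surjective_pairing fam2_r2_side.
rewrite derived_r2 jE -[(i, false).1]/i.
have xE : ((i, false), g) = rn 2 (((j, true), (vol i * g)%g) : vert Y) :> vert Y.
  by apply: (can_inj (@rnK _ Y 2)); rewrite derived_r2 jE rnK.
rewrite xE in ux; case: (petrie_flag_r2 j (vol i * g)%g) => [<-|<-] //.
exact: petrie_polygonS.
Qed.

(** [petrie_up_eq] separates corners in one half of the polygon, [petrie_up_r0] those in different
    halves. *)
Lemma corner_petrie_inj u i i' g : i < 4 * k -> i' < 4 * k ->
  petrie_polygon u (corner_petrie i g) -> petrie_polygon u (corner_petrie i' g) ->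
  i = i'.
Proof.
move=> lti lti'; rewrite /corner_petrie; set v := g Phi.
have up_neq := @petrie_up_r0 _ _ polyP petrieP u.
have up_eq' := @petrie_up_eq _ _ polyP petrieP u.
case: (ltnP i (2 * k)) => ik; case: (ltnP i' (2 * k)) => ik' ui ui'.
- suff : i.+2 = i'.+2 by lia.
  by apply: up_eq' ui ui'; lia.
- by case: (up_neq v (i' - 2 * k).+2 i.+2) => //; lia.
- by case: (up_neq v (i - 2 * k).+2 i'.+2) => //; lia.
- suff : (i - 2 * k).+2 = (i' - 2 * k).+2 by lia.
  by apply: up_eq' ui ui'; lia.
Qed.

Lemma joined_facet x x' : joined (fun c : 'I_3 => c <= 1) x x' -> x'.2 = x.2.
Proof.
move=> xx'; apply: (joined_ind (Q := fun w : vert Y => w.2 = x.2) _ xx') => //.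
move=> -[y g] c.
rewrite r_rn => c1 <-; case: c c1 => [[|[|c]] lt_c] // _.
  exact: (congr1 snd (derived_r0 y g)).
exact: (congr1 snd (derived_r1 y g)).
Qed.

Lemma joined_vertex x x' : joined (fun c : 'I_3 => 1 <= c) x x' ->
  petrie_polygon (petrie_flag x) (petrie_flag x').
Proof.
move=> xx'; pose Q w := petrie_polygon (petrie_flag x) (petrie_flag w).
apply: (joined_ind (Q := Q) _ xx'); last by exists 0; left.
by move=> w c c1; rewrite r_rn; apply: petrie_polygon_corner; rewrite c1 ltn_ord.
Qed.

(** The group element is constant on a facet, the Petrie polygon of [petrie_flag] on a vertex;
    together they determine the corner. *)
Lemma vertex_facet x x' :
  joined (fun c : 'I_3 => c <= 1) x x' -> joined (fun c : 'I_3 => 1 <= c) x x' ->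
  x' = x \/ x' = rn 1 x.
Proof.
case: x x' => y g [y' g'] xf /joined_vertex.
have /= -> := joined_facet xf; move=> vx.
have [->|->] : y' = y \/ y' = pg_r1 y; [|by left|right; exact: (esym (derived_r1 y g))].
apply/corner_eq/val_inj/(corner_petrie_inj (ltn_ord _) (ltn_ord _) _ vx).
by exists 0; left.
Qed.

(** * Rotating in a facet, crossing to the next, connectedness *)

Let k4_gt0 : 0 < 4 * k. Proof. lia. Qed.

Definition base_corner : 'I_(4 * k) := Ordinal k4_gt0.

Local Notation y0 := (base_corner, false).

Definition rot x : vert Y := rn 1 (rn 0 x).

Definition unrot x : vert Y := rn 0 (rn 1 x).

Lemma rotK : cancel rot unrot.
Proof. by move=> x; rewrite /rot /unrot !rnK. Qed.

Lemma iter_rotK m : cancel (iter m rot) (iter m unrot).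
Proof. by elim: m => // m IHm x; rewrite iterSr iterS rotK IHm. Qed.

Lemma iter_rotE m y g : iter m rot (y, g) = (iter m (@pg_rot _) y, g).
Proof. by elim: m => //= m ->; rewrite /rot derived_r0 derived_r1. Qed.

Lemma iter_unrotE m y g : iter m unrot (iter m (@pg_rot _) y, g) = (y, g).
Proof. by rewrite -iter_rotE iter_rotK. Qed.

(* [cross m] goes to the m-th next edge of the facet, crosses it, and in the
   neighbouring facet returns to the flag corresponding to the initial one. *)
Definition cross m x : vert Y :=
  iter m unrot (iter (2 * k) unrot (rn 0 (rn 2 (iter m rot x)))).

Lemma crossE m y g :
  cross m (y, g) = (y, (vol (iter m (@pg_rot _) y).1 * g)%g).
Proof.
by rewrite /cross iter_rotE derived_r2 derived_r0 /fam2_r2 pg_r0K !iter_unrotE.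
Qed.

Lemma aut_iter (a : aut Y) (f : vert Y -> vert Y) m x :
  (forall x, a (f x) = f (a x)) -> a (iter m f x) = iter m f (a x).
Proof. by move=> af; elim: m => //= m IHm; rewrite af IHm. Qed.

Lemma aut_cross (a : aut Y) m x : a (cross m x) = cross m (a x).
Proof.
rewrite /cross !(aut_iter (f := unrot)) => [|? |?]; try by rewrite /unrot !aut_rn.
by rewrite !aut_rn aut_iter // => ?; rewrite /rot !aut_rn.
Qed.

Lemma iter_rot_false m (i : 'I_(4 * k)) : i + m < 4 * k ->
  (iter m (@pg_rot _) (i, false)).1 = i + m :> nat.
Proof. by move=> im; rewrite iter_pg_rot /= iter_ordS modn_small. Qed.

Lemma iter_rot_true m (i j : 'I_(4 * k)) : (j + m) %% (4 * k) = i ->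
  (iter m (@pg_rot _) (i, true)).1 = j.
Proof.
move=> jm; rewrite iter_pg_rot /= -[RHS](iter_ord_predK m); congr iter.
by apply: val_inj; rewrite /= iter_ordS.
Qed.

Lemma facet_connected y g : joined (fun c : 'I_3 => c <= 1)
  ((y0, g) : vert Y) (y, g).
Proof.
have step m : joined (fun c : 'I_3 => c <= 1)
    ((y0, g) : vert Y) (iter m rot (y0, g)).
  elim: m => [|m /joined_trans]; first exact: joined_refl.
  apply; apply: joined_trans (joined_r _ _) (joined_r _ _); by rewrite inordK.
case: y => i b; have := step i; rewrite iter_rotE pg_rotE //.
case: b => // /joined_trans; apply.
rewrite -[(i, true)]/(pg_r0 (i, false)) -derived_r0.
by apply: joined_r; rewrite inordK.
Qed.

Lemma joined_predT (C : pred 'I_3) x x' : joined C x x' -> joined predT x x'.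
Proof. exact: joined_sub. Qed.

Lemma derived_connected : connected Y.
Proof.
split=> [|[y g] [y' g']]; first exact: (inhabits (y0, 1%g)).
have toy0 h z : joined predT ((y0, h) : vert Y) (z, h).
  exact: joined_predT (facet_connected z h).
apply: joined_trans (joined_sym (toy0 _ _)) (joined_trans _ (toy0 _ _)).
have step1 c x x' : joined predT x x' -> joined predT x (rn c x').
  by move=> /joined_trans; apply; apply: joined_r.
have step_unrot m x x' : joined predT x x' -> joined predT x (iter m unrot x').
  by elim: m => //= m IHm /IHm xx'; do 2!apply/step1.
have step_rot m x x' : joined predT x x' -> joined predT x (iter m rot x').
  by elim: m => //= m IHm /IHm xx'; do 2!apply/step1.
have step m x : joined predT x (cross m x).
  rewrite /cross; do 2!apply/step_unrot; do 2!apply/step1.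
  exact/step_rot/joined_refl.
(* The edge e_(j-1) carries tau_j, so the facets of all words in the tau_j are reached from that of
   1. *)
have crossV j h : 0 < j <= 2 * k -> cross j.-1 (y0, h) = (y0, (tau j * h)%g).
  move=> jn; rewrite crossE iter_rot_false /=; last lia.
  rewrite /vol add0n ifT; last lia.
  by rewrite prednK //; case/andP: jn.
have all_h h : joined predT ((y0, 1%g) : vert Y) (y0, h).
  elim/(tau_ind polyP chiralP tauE): h => [|j h jn IH]; first exact: joined_refl.
  split; apply: joined_trans IH _; first by rewrite -crossV.
  by rewrite -[in X in joined _ X](mulVKg (tau j) h) -crossV //; apply: joined_sym.
exact: joined_trans (joined_sym (all_h g)) (all_h g').
Qed.

Lemma fam2_r2_r0 y : fam2_r2 (pg_r0 y) = pg_r0 (fam2_r2 y).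
Proof.
rewrite [LHS]surjective_pairing [RHS]surjective_pairing; congr pair.
  exact/val_inj/(etrans (fam2_r2_edge (pg_r0 y)) (esym (fam2_r2_edge y))).
by rewrite fam2_r2_side -[RHS]/(~~ (fam2_r2 y).2) fam2_r2_side.
Qed.

Lemma derived_r0_r2 x : rn 0 (rn 2 x) = rn 2 (rn 0 x).
Proof.
case: x => y g; rewrite (derived_r2 y) (derived_r0 y) derived_r0 derived_r2.
by rewrite fam2_r2_r0.
Qed.

(** * The polytope axioms *)

Lemma derived_premaniplex : premaniplex Y.
Proof.
split=> [|i j ij x]; first exact: derived_connected.
rewrite -[walk _ _]/(r j (r i (r j (r i x)))) !r_rn.
have [[-> ->]|[-> ->]] : i = 0 :> nat /\ j = 2 :> nat \/
    i = 2 :> nat /\ j = 0 :> nat.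
- by have := ltn_ord i; have := ltn_ord j; lia.
- by rewrite -derived_r0_r2 !rnK.
- by rewrite derived_r0_r2 !rnK.
Qed.

(** The sides make the graph bipartite, which excludes semi-edges. *)
Lemma derived_side c x : (rn c x).1.2 = ~~ x.1.2.
Proof.
case: x => y g; case: (color3 (inord c)) => e; rewrite /rn e -/(rn _ _).
- by rewrite derived_r0.
- by rewrite derived_r1.
- by rewrite derived_r2 fam2_r2_side.
Qed.

Lemma pg_r1_edge y : ((pg_r1 y).1 : nat) =
  if y.2 then (if y.1.+1 == 4 * k then 0 else y.1.+1)
  else if y.1 == 0 :> nat then (4 * k).-1 else y.1.-1.
Proof.
case: y => i [] /=; last exact: val_ord_pred.
case: eqP => [->|ne]; first by rewrite modnn.
by rewrite modn_small //; have := ltn_ord i; lia.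
Qed.

Lemma derived_edge c (i : 'I_(4 * k)) b g : c < 3 ->
  ((rn c (((i, b), g) : vert Y)).1.1 : nat) =
  if c == 0 then i : nat
  else if c == 1 then
    (if b then (if i.+1 == 4 * k then 0 else i.+1)
     else if i == 0 :> nat then (4 * k).-1 else i.-1)
  else if i < 2 * k then i + 2 * k else i - 2 * k.
Proof.
case: c => [|[|[|//]]] _; first by rewrite derived_r0.
  by rewrite derived_r1 [LHS]pg_r1_edge.
by rewrite derived_r2 [LHS]fam2_r2_edge opposite_edge.
Qed.

(** The neighbors of a flag over e_i lie over e_i, one of e_(i+1) and e_(i-1), and e_(i+2k), which
    differ since k >= 2. *)
Lemma derived_simple : simple_graph Y.
Proof.
have termE (d : dart Y) : term d = rn (color d) (init d).
  by rewrite -r_rn /r dart_at_uniq.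
split=> [d|d d' ei]; rewrite !termE.
  by move=> e; have := derived_side (color d) (init d); rewrite e; case: (_.2).
rewrite ei => et; apply: dart_eq ei _; apply: ord_inj; move: et.
case: (init d') => [[i b] g] /(congr1 (fun x : vert Y => x.1.1 : nat)).
rewrite !derived_edge ?ltn_ord //.
have ik := ltn_ord i; have := ltn_ord (color d); have := ltn_ord (color d').
move: (nat_of_ord (color d)) (nat_of_ord (color d')) => c c'.
by case: c c' => [|[|[|//]]] [|[|[|//]]] _ _ //=; case: b; do ?case: ifP => ?; lia.
Qed.

Lemma derived_polytope : polytope Y.
Proof.
split; first by split; [exact: derived_premaniplex|exact: derived_simple].
move=> m j x x' xm xj.
(* If j = 0 or m = 2, one of the given paths suffices; what remains is m <= 1 <= j. *)
have [j0|j_gt0] := posnP j.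
  by apply: joined_sub xm => c; rewrite !unfold_in j0.
have [m2|m_lt2] := leqP 2 m.
  apply: joined_sub xj => c; rewrite !unfold_in => ->.
  by rewrite (leq_trans _ m2) // -ltnS.
have [||->|e] := @vertex_facet x x'; last 1 first.
(* Simplicity forbids joining x to r_1 x by color 0 alone or color 2 alone, so m = j = 1. *)
- have color1 c : joined (pred1 (inord c : 'I_3)) x x' -> c < 3 -> c = 1.
    rewrite {}e => /joined_pred1[/(simple_r_neq derived_simple)//|].
    move=> /(simple_r_inj derived_simple)/(congr1 (@nat_of_ord 3)) c1 c3.
    by rewrite !inordK in c1.
  have m1 : m = 1 :> nat.
    have [m0|] := posnP m; last lia.
    apply: color1; last exact: ltn_ord.
    by apply: joined_sub xm => c; rewrite !unfold_in m0 leqn0 -val_eqE /= inordK.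
  have j1 : j = 1 :> nat.
    have [|j2] := leqP j 1; first lia.
    apply: color1; last exact: ltn_ord.
    apply: joined_sub xj => c; rewrite !unfold_in inord_val -val_eqE /=.
    by have := ltn_ord c; have := ltn_ord j; lia.
  by rewrite e m1 j1; apply: joined_r; rewrite inordK.
- by apply: joined_sub xm => c; rewrite !unfold_in => /leq_trans; apply.
- by apply: joined_sub xj => c; rewrite !unfold_in; apply: leq_trans.
- exact: joined_refl.
Qed.

(** * Automorphisms of the derived graph *)

Definition word_voltage (ms : seq nat) y : aut P :=
  foldr (fun m g => vol (iter m (@pg_rot _) y).1 * g)%g 1%g ms.

(* Automorphisms commute with [cross m], so a relation among the voltages met
   from y' also holds from y. *)
Lemma aut_word_voltage (a : aut Y) ms y h y' h' :
  a (y, h) = (y', h') -> word_voltage ms y' = 1%g -> word_voltage ms y = 1%g.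
Proof.
have crosses z g : foldr cross (z, g) ms = (z, (word_voltage ms z * g)%g).
  by elim: ms => [|m ms /= ->]; rewrite ?mul1g // crossE mulgA.
move=> ah v1; have : a (foldr cross (y, h) ms) = a (y, h).
  transitivity (foldr cross (a (y, h)) ms); last by rewrite ah crosses v1 mul1g.
  by elim: ms {crosses v1} => //= m ms <-; rewrite aut_cross.
move=> /(can_inj (iso_vertK a)); rewrite crosses => -[] e.
by apply: (@mulIg _ h); rewrite e mul1g.
Qed.

Lemma cross_inj m : injective (cross m).
Proof.
move=> [y g] [y' g']; rewrite !crossE => e.
have /= <- := congr1 fst e; congr pair.
by have := congr1 snd e; have /= <- := congr1 fst e; apply: mulgI.
Qed.

Lemma vol_small i : i < 2 * k -> vol i = tau i.+1.
Proof. by rewrite /vol => ->. Qed.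

Lemma vol_large i : vol (i + 2 * k) = ((tau i.+1)^-1)%g.
Proof. by rewrite /vol addnK ltnNge leq_addl. Qed.

Lemma vol_invol i : i < 4 * k -> i != 0 -> i != 2 * k -> (vol i * vol i = 1)%g.
Proof.
move=> i4k i0 i2k; have [ik|ik] := ltnP i (2 * k).
  by rewrite vol_small // (tau_invol polyP tauE) //; lia.
rewrite -(subnK ik) vol_large -invgM (tau_invol polyP tauE) ?invg1 //; lia.
Qed.

(* tau_1 alone has a square different from 1, so i is 0 or 2k.  If b is true,
   then the relation (tau_1 tau_2k)^2 = 1 at y0 becomes (tau_1 tau_2)^2 = 1 or
   (tau_1^-1 tau_2)^2 = 1; if b is false and i = 2k, then a inverts every tau_j. *)
Lemma aut_fixes_base (a : aut Y) h : (a (y0, h)).1 = y0.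
Proof.
case ah: (a (y0, h)) => [[i b] h'] /=.
have vol_y0 m : m < 2 * k -> vol (iter m (@pg_rot (4 * k)) y0).1 = tau m.+1.
  by move=> mk; rewrite iter_rot_false /=; [rewrite vol_small|lia].
have tau21 := @tau2_not_inverts_tau1 _ _ _ _ polyP chiralP tauE.
have tau22 : (tau 2 * tau 2 = 1)%g by apply: (tau_invol polyP tauE); lia.
have tauV' : (tau 2)^-1%g = tau 2 by apply: mulg1_eq.
have i02 : i = 0 :> nat \/ i = 2 * k :> nat.
  have [->|i0] := eqVneq (i : nat) 0; first by left.
  have [->|i2k] := eqVneq (i : nat) (2 * k); first by right.
  case: (tau1_not_invol polyP chiralP tauE).
  have := aut_word_voltage (ms := [:: 0; 0]) ah.
  rewrite /word_voltage /foldr vol_y0 ?mulg1; last lia.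
  by apply; apply: vol_invol.
have {}bE : b = false.
  apply/negbTE/negP => b1; rewrite {}b1 in ah; apply: tau21; first lia.
  (* Relations pass from the image to the source, so the inverse carries one from y0 to (i,
     true). *)
  have ah' : (a^-1)%g ((i, true), h') = (y0, h) by rewrite -ah autVK.
  have := aut_word_voltage (ms := [:: 0; 2 * k - 1; 0; 2 * k - 1]) ah'.
  have y0_word : word_voltage [:: 0; 2 * k - 1; 0; 2 * k - 1] y0 = 1%g.
    rewrite /word_voltage /foldr !vol_y0 ?mulg1; [|lia..].
    have -> : (2 * k - 1).+1 = 2 * k by lia.
    by rewrite !mulgA (tau1_tau_invol polyP tauE) //; lia.
  move=> /(_ y0_word); rewrite /word_voltage /foldr mulg1.
  have corner_lt c : c < 4 * k -> exists j : 'I_(4 * k), j = c :> nat.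
    by move=> ck; exists (Ordinal ck).
  (* On side [true], 2k - 1 rotations lead from e_0 to e_(2k+1) and from e_2k to e_1, so tau_2 or
     its inverse takes the place of tau_2k. *)
  case: i02 => iE.
    have [|j jE] := corner_lt (1 + 2 * k); first lia.
    rewrite (@iter_rot_true (2 * k - 1) i j); last first.
      by rewrite jE iE -[in RHS](modnn (4 * k)); congr modn; lia.
    rewrite jE vol_large /= iE (@vol_small 0); last lia.
    by rewrite tauV' => /mulg1_eq ->; rewrite -!mulgA tau22 mulg1.
  have [|j jE] := corner_lt 1; first lia.
  rewrite (@iter_rot_true (2 * k - 1) i j); last first.
    by rewrite jE iE modn_small //; lia.
  rewrite jE (@vol_small 1) /= ?iE; last lia.
  rewrite (vol_large 0 : vol (2 * k) = _) => /mulg1_eq; rewrite invgK => e.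
  by rewrite [in LHS]e mulgA tau22 mul1g.
rewrite {}bE in ah *; congr pair; apply: val_inj => /=.
case: i02 => [//|i2k]; exfalso.
(* The inverting map is read off the fiber over y0: [cross j.-1] multiplies by tau_j there and by
   its inverse over (2k, false). *)
pose T g g' := a (y0, g * h)%g = ((i, false), g' * h')%g.
apply: (@chiral_no_inversion _ _ Phi tau polyP chiralP tauE T).
  split=> [|j g g' jn]; first by rewrite /T !mul1g.
  have jk : j.-1 < 2 * k by lia.
  have cross0 f : cross j.-1 (y0, f) = (y0, tau j * f)%g.
    by rewrite crossE vol_y0 // prednK //; lia.
  have crossi f : cross j.-1 ((i, false), f) = ((i, false), (tau j)^-1 * f)%g.
    rewrite crossE iter_rot_false; last by rewrite i2k; lia.
    by rewrite i2k addnC vol_large prednK //; lia.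
  rewrite /T => Tg; split.
    by rewrite -mulgA -cross0 aut_cross Tg crossi mulgA.
  apply: (@cross_inj j.-1).
  by rewrite -aut_cross cross0 crossi -!mulgA mulVKg mulKg.
move=> g'; rewrite /T mul1g ah => -[] e.
by apply: (@mulIg _ h'); rewrite -e mul1g.
Qed.

(** By [aut_fixes_base] some translation agrees with [a] at one flag, which determines an
    automorphism of a connected graph. *)
Lemma aut_translation (a : aut Y) : exists h, forall x, a x = (x.1, (x.2 * h)%g).
Proof.
case e : (a (y0, 1%g)) => [z h].
have [s sE] := derived_translation (fam2_voltage k tau) h.
suff -> : a = s by exists h.
apply: (@aut_eq_at _ Y (y0, 1%g)); first exact: derived_connected.
by rewrite sE e mul1g; congr pair; rewrite -(aut_fixes_base a 1%g) e.
Qed.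

Lemma derived_flag_orbit x x' : flag_orbit x x' <-> x.1 = x'.1.
Proof.
split=> [[a <-]|e]; first by have [h ->] := aut_translation a.
have [s sE] := derived_translation (fam2_voltage k tau) (x.2^-1 * x'.2)%g.
by exists s; rewrite sE mulVKg e -surjective_pairing.
Qed.

(** * Transitivity, facet stabilizers and the symmetry type graph *)

Lemma derived_facet_transitive : facet_transitive Y.
Proof.
move=> _ _ [[y g] ->] [[y' g'] ->].
have [s sE] := derived_translation (fam2_voltage k tau) (g^-1 * g')%g.
exists s; rewrite image_face sE mulVKg; apply/face_eqP.
have sub z h : joined (predC1 ord_max) ((y0, h) : vert Y) (z, h).
  apply: joined_sub (facet_connected z h) => c; rewrite !unfold_in /= -val_eqE /=.
  by have := ltn_ord c; lia.
exact: joined_trans (joined_sym (sub _ _)) (sub _ _).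
Qed.

(** Flags of one facet share their group element, so a translation preserving the facet is
    trivial. *)
Lemma derived_facet_stabilizer : trivial_facet_stabilizer Y.
Proof.
move=> _ s [x ->]; rewrite image_face => /face_eqP xsx.
apply: (@aut_eq_at _ _ x); first exact: derived_connected.
have [h sE] := aut_translation s; rewrite sE aut1E [RHS]surjective_pairing.
have : (s x).2 = x.2.
  apply/esym/joined_facet; apply: joined_sub xsx => c.
  rewrite !unfold_in /= -val_eqE /=.
  by have := ltn_ord c; lia.
by rewrite sE /= => ->.
Qed.

(** Within a vertex, r_2 r_1 takes (i, false) over to (i + 2k - 1, false) modulo 4k. This changes
    the parity of i, and two such steps lower i by 2, so 0 is reached. *)
Lemma vertex_base x : exists h, face ord0 x = face ord0 ((y0, h) : vert Y).
Proof.
suff [h xh] : exists h, joined (fun c : 'I_3 => 1 <= c) x (y0, h).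
  exists h; apply/face_eqP; apply: joined_sub xh => c.
  by rewrite !unfold_in /= -val_eqE /= lt0n.
pose reach x' := exists h, joined (fun c : 'I_3 => 1 <= c) x' (y0, h).
rewrite -/(reach x).
have reach_rn c x' : 0 < c < 3 -> reach (rn c x') -> reach x'.
  move=> /andP[c0 c3] [h xh]; exists h; apply: joined_trans xh.
  by apply: joined_r; rewrite inordK.
have step (i : 'I_(4 * k)) g : 0 < i -> exists (j : 'I_(4 * k)) g',
    (reach ((j, false), g') -> reach ((i, false), g)) /\
    (j = i.-1 + 2 * k :> nat \/ i.-1 = j + 2 * k).
  move=> i_gt0; exists (fam2_r2 (ord_pred i, true)).1, (vol (ord_pred i) * g)%g.
  split=> [rj|]; last first.
    rewrite fam2_r2_edge opposite_edge // val_ord_pred.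
    by case: eqP => [i0|_]; [rewrite i0 in i_gt0|case: ltnP; lia].
  apply: (reach_rn 1) => //; apply: (reach_rn 2) => //; rewrite derived_r1 derived_r2.
  by rewrite [fam2_r2 _]surjective_pairing fam2_r2_side.
have even_case m (i : 'I_(4 * k)) g : i = m.*2 :> nat -> reach ((i, false), g).
  elim: m i g => [|m IHm] i g iE.
    have -> : i = base_corner by apply: val_inj; rewrite /= iE.
    by exists g; apply: joined_refl.
  have [|j [g' [+ jE]]] := step i g; [lia|apply].
  have [|j' [g'' [+ j'E]]] := step j g'; [lia|apply].
  by apply: IHm; have := ltn_ord i; have := ltn_ord j'; lia.
have all_false i g : reach ((i, false), g).
  have [odd_i|even_i] := boolP (odd i); last by apply: (even_case i./2); lia.
  have [|j [g' [+ jE]]] := step i g; [lia|apply].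
  by apply: (even_case j./2); lia.
case: x => [[i []] g]; last exact: all_false.
by apply: (reach_rn 1); rewrite // derived_r1; apply: all_false.
Qed.

Lemma derived_vertex_transitive : vertex_transitive Y.
Proof.
move=> _ _ [x ->] [x' ->].
have [h ->] := vertex_base x; have [h' ->] := vertex_base x'.
have [s sE] := derived_translation (fam2_voltage k tau) (h^-1 * h')%g.
by exists s; rewrite image_face sE mulVKg.
Qed.

(** Orbits are the fibers over the flags of the premaniplex, so any representative of an orbit names
    its flag. *)
Lemma derived_symmetry_type_graph : inhabited (iso (symmetry_type_graph Y) (family2 k)).
Proof.
pose f (O : orbit_type Y) : flag := (projT1 (cid (svalP O))).1.
have fE O x : sval O = flag_orbit x -> f O = x.1.
  rewrite /f; case: cid => z /= -> e; apply/derived_flag_orbit.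
  by rewrite e; apply/derived_flag_orbit.
pose g y : orbit_type Y :=
  exist _ (flag_orbit ((y, 1%g) : vert Y)) (ex_intro _ _ erefl).
have [||i O|F _] := @iso_of_bij _ (symmetry_type_graph Y) (family2 k) f g.
- have sval_eq (A B : orbit_type Y) : sval A = sval B -> A = B.
    by case: A B => A pA [B pB] /= ?; apply: eq_exist.
  move=> O; have [x Ox] := svalP O; apply: sval_eq.
  rewrite (fE _ _ Ox) Ox; apply/flag_orbit_eqP.
  exact/(@derived_flag_orbit (x.1, 1%g) x).
- by move=> y; rewrite (fE _ (y, 1%g)).
- have [x Ox] := svalP O.
  rewrite (fE _ _ Ox) (fE _ (r i x)); last first.
    by rewrite -[LHS]/(r i @` sval O) Ox r_flag_orbit.
  by case: x {Ox}.
- exact: inhabits F.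
Qed.

End DerivedFamily2.

Unset Implicit Arguments.

Theorem theorem7p2 (k : nat) (hk : 2 <= k) (P : cgraph (2 * k).+1)
  (hP : polytope P) (hchiral : chiral P) (hpetrie : simple_petrie_polygons P)
  (Phi : vert P) :
  (forall i : 'I_(2 * k).+1, 1 <= i ->
     exists! t : aut P, t Phi = r i (r ord0 Phi)) /\
  forall tau : nat -> aut P,
    (forall i : 'I_(2 * k).+1, 1 <= i -> tau i Phi = r i (r ord0 Phi)) ->
    (forall g : aut P,
       generated (fun t : aut P => exists i, 1 <= i <= 2 * k /\ t = tau i) g) /\
    let Xxi := derived (fam2_voltage k tau) in
    polytope Xxi /\
    inhabited (iso (symmetry_type_graph Xxi) (family2 k)) /\
    vertex_transitive Xxi /\
    facet_transitive Xxi /\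
    trivial_facet_stabilizer Xxi.
Proof.
split=> [i _|tau tauE'].
  have [t tE] := chiral_rotation hchiral i ord0 Phi; exists t; split=> // t' t'E.
  by apply: (aut_eq_at hP.1.1.1 (v := Phi)); rewrite tE.
have tauE j : 0 < j <= 2 * k -> tau j Phi = rn j (rn 0 Phi).
  move=> /andP[j0 jk]; have := tauE' (inord j).
  by rewrite inordK // => /(_ j0) ->; rewrite rn0.
split; first by move=> g; apply: (generated_tau hP hchiral tauE).
move=> Xxi; split; first exact: derived_polytope hk hP hchiral hpetrie tauE.
split; first exact: derived_symmetry_type_graph hk hP hchiral tauE.
split; first exact: derived_vertex_transitive.
split; first exact: derived_facet_transitive.
exact: derived_facet_stabilizer hk hP hchiral tauE.
Qed.
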